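(* Let $\beta\ge 1\ge\alpha>0$. Then there exists a pointwise maximal function $B_{\alpha,\beta}$ in the family $\mathcal{F}_{\alpha,\beta}$; that is, there is a non-negative continuous function $B_{\alpha,\beta}:[0,1]\to[0,\infty)$ with $B_{\alpha,\beta}(0)=B_{\alpha,\beta}(1)=0$ satisfying the two-point inequality \[ B_{\alpha,\beta}\Big(\frac{x+y}{2}\Big)^{\alpha}\le \frac12\Big(B_{\alpha,\beta}(x)^{\beta}+\Big|\frac{x-y}{2}\Big|^{\beta}\Big)^{\alpha/\beta}+\frac12\Big(B_{\alpha,\beta}(y)^{\beta}+\Big|\frac{x-y}{2}\Big|^{\beta}\Big)^{\alpha/\beta}\qquad\text{for all }x,y\in[0,1], \] and such that $f(t)\le B_{\alpha,\beta}(t)$ for every $f\in\mathcal{F}_{\alpha,\beta}$ and every $t\in[0,1]$.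
   Context: For $\beta\ge 1\ge\alpha>0$, $\mathcal{F}_{\alpha,\beta}$ is the family of all non-negative continuous functions $f$ on $[0,1]$ with $f(0)=f(1)=0$ satisfying \[ f\Big(\frac{x+y}{2}\Big)^{\alpha}\le \frac12\Big(f(x)^{\beta}+\Big|\frac{x-y}{2}\Big|^{\beta}\Big)^{\alpha/\beta}+\frac12\Big(f(y)^{\beta}+\Big|\frac{x-y}{2}\Big|^{\beta}\Big)^{\alpha/\beta}\qquad\text{for all }x,y\in[0,1]. \] *)

(* Defs.v *)
From HB Require Import structures.
From mathcomp Require Import all_boot all_order all_algebra.
From mathcomp Require Import all_classical all_reals all_analysis.
Set Implicit Arguments.
Unset Strict Implicit.
Unset Printing Implicit Defensive.
Import Order.TTheory GRing.Theory Num.Theory.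
Import numFieldNormedType.Exports.
Local Open Scope classical_set_scope.
Local Open Scope ring_scope.

(* All powers below have non-negative base and positive exponent, where [powR]
   is the usual power; in particular [0 `^ p = 0] for [p != 0]. *)
Definition two_point_ineq (R : realType) (alpha beta : R) (f : R -> R) : Prop :=
  forall x y : R, x \in `[0, 1] -> y \in `[0, 1] ->
    f ((x + y) / 2) `^ alpha <=
      2^-1 * (f x `^ beta + `|(x - y) / 2| `^ beta) `^ (alpha / beta) +
      2^-1 * (f y `^ beta + `|(x - y) / 2| `^ beta) `^ (alpha / beta).

(* A function on [0, 1] is represented by a function on [R] whose values outside
   [0, 1] are irrelevant: every condition only concerns its restriction. *)
Definition family_F (R : realType) (alpha beta : R) : set (R -> R) :=
  [set f : R -> R | [/\ {within `[(0 : R), (1 : R)], continuous f},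
               forall t : R, t \in `[0, 1] -> 0 <= f t,
               f 0 = 0, f 1 = 0 &
               two_point_ineq alpha beta f] ].

(* Main.v *)
Require Import Defs.
From HB Require Import structures.
From mathcomp Require Import all_boot all_order all_algebra.
From mathcomp Require Import all_classical all_reals all_analysis.
From mathcomp Require Import lra ring.
Set Implicit Arguments.
Unset Strict Implicit.
Unset Printing Implicit Defensive.
Import Order.TTheory GRing.Theory Num.Theory.
Import numFieldNormedType.Exports.
Local Open Scope classical_set_scope.
Local Open Scope ring_scope.

(** With [g = f^alpha], subadditivity of [s |-> s^(alpha/beta)] turns the
    two-point inequality into approximate midpoint convexity
    [g((x+y)/2) <= (g x + g y)/2 + |(x-y)/2|^alpha]. At a maximum of [g] this
    gives [g <= 2], so the pointwise supremum [B] of the family is finite, and it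
    inherits the two-point inequality because the right-hand side is monotone in
    the values of [f]. Continuity of [B] needs no equicontinuity of the family:
    any bounded non-negative approximately midpoint convex function vanishing at
    the endpoints is uniformly continuous. Indeed iterating the inequality on
    dyadic dilations of a step gives [g(u+h) - g(u) <= 2/2^k + k h^alpha]
    whenever [u + 2^k h <= 1]. *)

(** * Approximate midpoint convexity and the bound at a maximum *)

(** A ratio [c / (a + b)] in [0, 1] is at most its [p]-th power because [p <= 1]. Multiplying by
    [(a + b) ^ p] and adding the cases [c = a] and [c = b] gives the claim. *)
Lemma powR_add_le (R : realType) (p a b : R) : 0 < p -> p <= 1 ->
  0 <= a -> 0 <= b -> (a + b) `^ p <= a `^ p + b `^ p.
Proof.
move=> p0 p1 a0 b0.
have [s0|s0] := leP (a + b) 0.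
  have -> : a + b = 0 by lra.
  by rewrite powR0 ?gt_eqF// addr_ge0 ?powR_ge0.
have frac c : 0 <= c -> c <= a + b -> c / (a + b) * (a + b) `^ p <= c `^ p.
  move=> c0 cs.
  have [->|cn0] := eqVneq c 0; first by rewrite !mul0r powR_ge0.
  have cgt0 : 0 < c by rewrite lt_def cn0.
  rewrite -{2}(divfK (lt0r_neq0 s0) c) powRM ?divr_ge0 ?(ltW s0)//.
  rewrite ler_wpM2r ?powR_ge0// ger1_powR// divr_gt0//=.
  by rewrite ler_pdivrMr// mul1r.
have -> : (a + b) `^ p =
    a / (a + b) * (a + b) `^ p + b / (a + b) * (a + b) `^ p.
  by rewrite -mulrDl -mulrDl divff ?gt_eqF// mul1r.
by rewrite lerD// frac//; lra.
Qed.

Definition approx_midconvex (R : realType) (p : R) (g : R -> R) : Prop :=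
  forall x y : R, x \in `[0, 1] -> y \in `[0, 1] ->
    g ((x + y) / 2) <= 2^-1 * g x + 2^-1 * g y + `|(x - y) / 2| `^ p.

Lemma two_point_ineq_approx_midconvex (R : realType) (alpha beta : R)
    (f : R -> R) : 0 < alpha -> alpha <= 1 -> 1 <= beta ->
  (forall t : R, t \in `[0, 1] -> 0 <= f t) ->
  two_point_ineq alpha beta f ->
  approx_midconvex alpha (fun t => f t `^ alpha).
Proof.
move=> a0 a1 b1 f0 ff x y xI yI /=.
have b0 : 0 < beta by lra.
have bn0 : beta != 0 by rewrite gt_eqF.
have key a c : 0 <= a -> 0 <= c ->
    (a `^ beta + c `^ beta) `^ (alpha / beta) <= a `^ alpha + c `^ alpha.
  move=> ? ?; apply: le_trans (powR_add_le _ _ _ _) _; rewrite ?powR_ge0//.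
  - by rewrite divr_gt0.
  - by rewrite ler_pdivrMr//; lra.
  - by rewrite -!powRrM [beta * _]mulrC divfK.
apply: le_trans (ff _ _ xI yI) _.
have -> (s t d : R) : 2^-1 * s + 2^-1 * t + d =
    2^-1 * (s + d) + 2^-1 * (t + d) by field.
by rewrite lerD// ler_wpM2l ?invr_ge0// key ?f0.
Qed.

(** The maximum point [c] is the midpoint of [0] and [2c], or of [2c - 1] and [1]. As [g] vanishes
    at the endpoints, [g c <= g c / 2 + 1]. *)
Lemma approx_midconvex_le2 (R : realType) (p : R) (g : R -> R) (c : R) :
  0 < p -> approx_midconvex p g -> g 0 = 0 -> g 1 = 0 -> c \in `[0, 1] ->
  (forall t : R, t \in `[0, 1] -> g t <= g c) ->
  forall t : R, t \in `[0, 1] -> g t <= 2.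
Proof.
move=> p0 mg g0 g1 cI gc t tI; apply: le_trans (gc _ tI) _.
have pow1 a : 0 <= a -> a <= 1 -> a `^ p <= 1.
  move=> ? ?; rewrite [leRHS](_ : 1 = 1 `^ p); last by rewrite powR1.
  by apply: ge0_ler_powR; rewrite ?nnegrE ?(ltW p0).
have I0 : (0 : R) \in `[0, 1] by rewrite in_itv/=; lra.
have I1 : (1 : R) \in `[0, 1] by rewrite in_itv/=; lra.
move: (cI); rewrite in_itv/= => /andP[c0 c1].
have [c2|c2] := leP c 2^-1.
- have dI : 2 * c \in `[0, 1] by rewrite in_itv/=; lra.
  have := mg _ _ I0 dI; have := gc _ dI.
  have := pow1 `|(0 - 2 * c) / 2| (normr_ge0 _).
  have -> : (0 - 2 * c) / 2 = - c by field.
  have -> : (0 + 2 * c) / 2 = c by field.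
  rewrite normrN ger0_norm// g0 => /(_ c1); lra.
- have dI : 2 * c - 1 \in `[0, 1] by rewrite in_itv/=; lra.
  have := mg _ _ dI I1; have := gc _ dI.
  have := pow1 `|(2 * c - 1 - 1) / 2| (normr_ge0 _).
  have -> : (2 * c - 1 - 1) / 2 = - (1 - c) by field.
  have -> : (2 * c - 1 + 1) / 2 = c by field.
  rewrite normrN ger0_norm ?g1 => [/(_ _)|]; lra.
Qed.

(** * Modulus of continuity from dyadic dilation *)

(** Since [u + h] is the midpoint of [u] and [u + 2h], the increment for [h] is at most half the
    increment for [2h] plus [h ^ p]. Induction on [k] iterates this. *)
Lemma approx_midconvex_increment (R : realType) (p : R) (g : R -> R) :
  0 < p -> p <= 1 -> approx_midconvex p g ->
  (forall t : R, t \in `[0, 1] -> 0 <= g t <= 2) ->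
  forall (k : nat) (u h : R), 0 <= u -> 0 <= h -> u + 2 ^+ k * h <= 1 ->
  g (u + h) - g u <= 2 / 2 ^+ k + k%:R * h `^ p.
Proof.
move=> p0 p1 mg gb; elim=> [|k IH] u h u0 h0 uh.
  rewrite expr0 divr1 mul0r addr0.
  rewrite expr0 mul1r in uh.
  have /gb/andP[_] : u + h \in `[0, 1] by rewrite in_itv/=; lra.
  have /gb/andP[+ _] : u \in `[0, 1] by rewrite in_itv/=; lra.
  lra.
have k1 : 1 <= 2 ^+ k :> R by rewrite exprn_ege1// ler1n.
rewrite exprS in uh.
have := IH u (2 * h) u0.
rewrite mulr_ge0// mulrA [2 ^+ k * 2]mulrC => /(_ isT uh) {}IH.
have uI : u \in `[0, 1] by rewrite in_itv/=; nra.
have vI : u + 2 * h \in `[0, 1] by rewrite in_itv/=; nra.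
have := mg _ _ uI vI.
have -> : (u + (u + 2 * h)) / 2 = u + h by field.
have -> : (u - (u + 2 * h)) / 2 = - h by field.
rewrite normrN ger0_norm// => gu.
(* The factor [2] cancels against the halving, so each doubling costs just one more [h ^ p]. *)
have pow2 : (2 * h) `^ p <= 2 * h `^ p.
  by rewrite powRM// ler_wpM2r ?powR_ge0// ler1_powR// ler1n.
have kpow : k%:R * (2 * h) `^ p <= k%:R * (2 * h `^ p) by rewrite ler_wpM2l.
have -> : 2 / 2 ^+ k.+1 = 2^-1 * (2 / 2 ^+ k) :> R.
  by rewrite exprS; field; rewrite expf_neq0.
rewrite -(natr1 k); nra.
Qed.

Lemma approx_midconvex_reflect (R : realType) (p : R) (g : R -> R) :
  approx_midconvex p g -> approx_midconvex p (fun t => g (1 - t)).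
Proof.
move=> mg x y xI yI.
have refl (t : R) : t \in `[0, 1] -> 1 - t \in `[0, 1].
  by rewrite !in_itv/= => /andP[? ?]; lra.
have := mg _ _ (refl _ xI) (refl _ yI).
have -> : (1 - x + (1 - y)) / 2 = 1 - (x + y) / 2 by field.
have -> : (1 - x - (1 - y)) / 2 = - ((x - y) / 2) by field.
by rewrite normrN.
Qed.

Lemma approx_midconvex_rise (R : realType) (p : R) (g : R -> R) :
  0 < p -> p <= 1 -> approx_midconvex p g ->
  (forall t : R, t \in `[0, 1] -> 0 <= g t <= 2) -> g 1 = 0 ->
  forall eps : R, 0 < eps -> exists2 delta : R, 0 < delta &
    forall u v : R, 0 <= u -> u <= v -> v <= 1 -> v - u < delta ->
    g v - g u < eps.
Proof.
move=> p0 p1 mg gb g1 eps e0.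
pose k := Num.Def.archi_bound (4 / eps).
have k2 : 4 / eps < 2 ^+ k by apply: upper_nthrootP.
have pk : 0 < 2 ^+ k :> R by rewrite exprn_gt0.
have small2 : 2 / 2 ^+ k < eps / 2.
  by move: k2; rewrite !ltr_pdivrMr//; lra.
(* [c] bounds [h ^ p] so that [k] such terms stay within [eps / 2]; [k.+1] keeps the divisor
   nonzero. *)
pose c : R := eps / (2 * k.+1%:R).
have c0 : 0 < c by rewrite divr_gt0// mulr_gt0.
(* The first bound lets a step [eta] starting at [0] be dilated [k] times inside [0, 1]; the second
   gives [h ^ p <= c] for [h <= eta]. *)
pose eta : R := Num.min (2 ^+ k)^-1 (c `^ p^-1).
have eta0 : 0 < eta by rewrite lt_min invr_gt0 pk powR_gt0.
have eta1 : 2 ^+ k * eta <= 1.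
  by rewrite mulrC -ler_pdivlMr// mul1r ge_min lexx.
have eta2 h : 0 <= h -> h <= eta -> k%:R * h `^ p <= eps / 2.
  move=> h0 he.
  have hp : h `^ p <= c.
    rewrite -[leRHS]powRr1 ?(ltW c0)// -(mulVf (lt0r_neq0 p0)) powRrM.
    apply: ge0_ler_powR; rewrite ?nnegrE ?powR_ge0 ?(ltW p0)//.
    by apply: le_trans he _; rewrite ge_min lexx orbT.
  have -> : eps / 2 = k.+1%:R * c.
    have : k.+1%:R != 0 :> R by rewrite pnatr_eq0.
    by rewrite /c; move: k.+1%:R => K K0; field.
  by apply: ler_pM; rewrite ?powR_ge0// ler_nat.
have k1 : 1 <= 2 ^+ k :> R by rewrite exprn_ege1// ler1n.
(* Near the right endpoint a step cannot be dilated to the right. There the rise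
   is at most [g v], which is the increment at [0] of the reflected function. *)
have edge v : 0 <= v -> v <= 1 -> 1 - v <= eta -> g v < eps.
  move=> v0 v1 ve.
  have gb' t : t \in `[0, 1] -> 0 <= g (1 - t) <= 2.
    by rewrite in_itv/= => /andP[? ?]; apply: gb; rewrite in_itv/=; lra.
  have := @approx_midconvex_increment _ _ _ p0 p1
    (approx_midconvex_reflect mg) gb' k 0 (1 - v) (lexx _).
  rewrite !add0r subr0 g1 subr0 subKr subr_ge0 => /(_ v1).
  have := eta2 (1 - v); rewrite subr_ge0 => /(_ v1 ve).
  have : 2 ^+ k * (1 - v) <= 2 ^+ k * eta by rewrite ler_wpM2l// ltW.
  move=> le1 le2 /(_ (le_trans le1 eta1)); lra.
(* With this choice the dilated step is shorter than [eta], so it fits to the right of [u] unless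
   [u] is within [eta] of [1], where [edge] applies to [v]. *)
exists (eta / 2 ^+ k); first by rewrite divr_gt0.
move=> u v u0 uv v1 vu.
have vu' : 2 ^+ k * (v - u) < eta by rewrite mulrC -ltr_pdivlMr.
have [ue|ue] := leP (1 - u) eta.
  have := edge v; have /gb/andP[+ _] : u \in `[0, 1] by rewrite in_itv/=; lra.
  move=> ? /(_ _ _ _); lra.
have := @approx_midconvex_increment _ _ _ p0 p1 mg gb k u (v - u) u0.
rewrite subr_ge0 => /(_ uv).
have := eta2 (v - u); rewrite subr_ge0 => /(_ uv).
have -> : u + (v - u) = v by ring.
have hle : v - u <= eta by nra.
move=> /(_ hle) ? inc.
have /inc : u + 2 ^+ k * (v - u) <= 1 by lra.
lra.
Qed.

(** For [v < u], the reflection [t |-> 1 - t] turns the increment into a rise from left to right. *)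
Lemma approx_midconvex_uniform_continuous (R : realType) (p : R) (g : R -> R) :
  0 < p -> p <= 1 -> approx_midconvex p g ->
  (forall t : R, t \in `[0, 1] -> 0 <= g t <= 2) -> g 0 = 0 -> g 1 = 0 ->
  forall eps : R, 0 < eps -> exists2 delta : R, 0 < delta &
    forall u v : R, u \in `[0, 1] -> v \in `[0, 1] -> `|u - v| < delta ->
    g v - g u < eps.
Proof.
move=> p0 p1 mg gb g0 g1 eps e0.
have gb' t : t \in `[0, 1] -> 0 <= g (1 - t) <= 2.
  by rewrite in_itv/= => /andP[? ?]; apply: gb; rewrite in_itv/=; lra.
have [d d0 dP] := approx_midconvex_rise p0 p1 mg gb g1 e0.
have g10 : g (1 - 1) = 0 by rewrite subrr.
have [d' d'0 d'P] := approx_midconvex_rise p0 p1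
  (approx_midconvex_reflect mg) gb' g10 e0.
exists (Num.min d d'); first by rewrite lt_min d0.
move=> u v; rewrite !in_itv/= => /andP[u0 u1] /andP[v0 v1].
rewrite lt_min => /andP[]; rewrite !ltr_norml => /andP[? ?] /andP[? ?].
have [uv|uv] := leP u v; first by apply: dP; lra.
by have := d'P (1 - u) (1 - v); rewrite !subKr; apply; lra.
Qed.

(** * Return from [f ^ p] to [f] *)

(** Powers are strictly increasing on non-negative reals, so a tolerance [eps] around [f x]
    corresponds to positive gaps above and below [f x ^ p]. *)
Lemma continuous_of_powR (R : realType) (p : R) (f : R -> R) :
  0 < p -> (forall t : R, t \in `[0, 1] -> 0 <= f t) ->
  (forall eps : R, 0 < eps -> exists2 delta : R, 0 < delta &
    forall u v : R, u \in `[0, 1] -> v \in `[0, 1] -> `|u - v| < delta ->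
    f v `^ p - f u `^ p < eps) ->
  {within `[(0 : R), (1 : R)], continuous f}.
Proof.
move=> p0 f0 fc; apply/subspace_continuousP => x xI.
have xI' : x \in `[0, 1] by [].
apply/cvgrPdist_lt => /= eps e0.
have fx0 := f0 _ xI'.
have mono a b : 0 <= a -> 0 <= b -> a `^ p < b `^ p -> a < b.
  move=> a0 b0; rewrite !ltNge; apply: contra => ba.
  by apply: ge0_ler_powR; rewrite ?nnegrE ?(ltW p0).
have up0 : 0 < (f x + eps) `^ p - f x `^ p.
  by rewrite subr_gt0; apply: gt0_ltr_powR; rewrite ?nnegrE//; lra.
have [d1 d10 d1P] := fc _ up0.
(* If [f x < eps], the lower bound is negative and holds by [f v >= 0]; otherwise [f x - eps] is a
   legitimate base for the power. *)
have [d2 d20 d2P] : exists2 d : R, 0 < d & forall v : R, v \in `[0, 1] ->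
    `|v - x| < d -> f x - eps < f v.
  have [xe|xe] := ltP (f x) eps.
    by exists 1 => // v /f0 ? _; lra.
  have dn0 : 0 < f x `^ p - (f x - eps) `^ p.
    by rewrite subr_gt0; apply: gt0_ltr_powR; rewrite ?nnegrE//; lra.
  have [d d0 dP] := fc _ dn0; exists d => // v vI vd.
  by apply: mono; rewrite ?f0 ?subr_ge0//; have := dP _ _ vI xI' vd; lra.
have dm : 0 < Num.min d1 d2 by rewrite lt_min d10.
apply/nbhs_ballP; exists (Num.min d1 d2) => //= v xv vI.
have vI' : v \in `[0, 1] by [].
move: xv; rewrite /ball/= lt_min => /andP[xv1 xv2].
have hi : f v < f x + eps.
  by apply: mono; rewrite ?f0//; [lra|have := d1P _ _ xI' vI' xv1; lra].
have := d2P _ vI'; rewrite distrC => /(_ xv2) ?.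
by rewrite ltr_distlC; apply/andP; split.
Qed.

(** * The family and its pointwise supremum *)

Lemma family_F0 (R : realType) (alpha beta : R) : 0 < alpha ->
  family_F alpha beta (fun=> 0).
Proof.
move=> a0; split=> //; first by move=> x; apply: cvg_cst.
by move=> x y _ _; rewrite powR0 ?gt_eqF//.
Qed.

Lemma family_F_powR_le2 (R : realType) (alpha beta : R) (f : R -> R) :
  0 < alpha -> alpha <= 1 -> 1 <= beta -> family_F alpha beta f ->
  forall t : R, t \in `[0, 1] -> f t `^ alpha <= 2.
Proof.
move=> a0 a1 b1 [fc f0 f00 f01 ff].
have [c cI cP] := EVT_max ler01 fc.
have an0 : alpha != 0 by rewrite gt_eqF.
apply: (@approx_midconvex_le2 _ alpha _ c) => //.
- exact: two_point_ineq_approx_midconvex a0 a1 b1 f0 ff.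
- by rewrite f00 powR0.
- by rewrite f01 powR0.
- move=> t tI; apply: ge0_ler_powR; rewrite ?nnegrE ?f0 ?(ltW a0)//.
  exact: cP.
Qed.

Theorem proposition1p3 (R : realType) (alpha beta : R)
    (alpha_gt0 : 0 < alpha) (alpha_le1 : alpha <= 1) (beta_ge1 : 1 <= beta) :
  exists B : R -> R,
    family_F alpha beta B /\
    forall f : R -> R, family_F alpha beta f ->
      forall t : R, t \in `[0, 1] -> f t <= B t.
Proof.
have an0 : alpha != 0 by rewrite gt_eqF.
have beta_gt0 : 0 < beta by lra.
have root a c : 0 <= a -> 0 <= c -> a `^ alpha <= c -> a <= c `^ alpha^-1.
  move=> a0 c0 ac; rewrite -[a]powRr1// -(mulfV an0) powRrM.
  by apply: ge0_ler_powR; rewrite ?nnegrE ?powR_ge0 ?invr_ge0 ?(ltW alpha_gt0).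
have rootK c : 0 <= c -> (c `^ alpha^-1) `^ alpha = c.
  by move=> c0; rewrite -powRrM mulVf// powRr1.
pose V t := [set f t | f in @family_F R alpha beta].
have V0 t : V t 0 by exists (fun=> 0) => //; apply: family_F0.
have Vub t : t \in `[0, 1] -> ubound (V t) (2 `^ alpha^-1).
  move=> tI _ [f fF <-]; have [_ f0 _ _ _] := fF.
  by apply: root; rewrite ?f0//; apply: family_F_powR_le2 fF _ tI.
(* [sup] is a default value on empty or unbounded sets; [V0] and [Vub] rule these out on [0, 1]. *)
pose B t := sup (V t).
have leB f : family_F alpha beta f -> forall t : R, t \in `[0, 1] -> f t <= B t.
  move=> fF t tI; apply: ub_le_sup; last by exists f.
  by exists (2 `^ alpha^-1); apply: Vub.
have Ble t c : (forall f, family_F alpha beta f -> f t <= c) -> B t <= c.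
  by move=> h; apply: ge_sup; [exists 0 | move=> _ [f /h + <-]].
have I0 : (0 : R) \in `[0, 1] by rewrite in_itv/=; lra.
have I1 : (1 : R) \in `[0, 1] by rewrite in_itv/=; lra.
have B0 t : t \in `[0, 1] -> 0 <= B t.
  by move=> tI; apply: (leB (fun=> 0)) => //; apply: family_F0.
have B00 : B 0 = 0.
  by apply/eqP; rewrite eq_le B0// andbT; apply: Ble => f [_ _ -> _ _].
have B01 : B 1 = 0.
  by apply/eqP; rewrite eq_le B0// andbT; apply: Ble => f [_ _ _ -> _].
have BB : two_point_ineq alpha beta B.
  move=> x y xI yI; set d := `|_|; set rhs := leRHS.
  have rhs0 : 0 <= rhs.
    by rewrite addr_ge0// mulr_ge0 ?powR_ge0 ?invr_ge0.
  have mI : (x + y) / 2 \in `[0, 1].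
    by move: xI yI; rewrite !in_itv/= => /andP[? ?] /andP[? ?]; lra.
  (* [B] is a supremum of values [f t], not of their powers, so the bound is moved to
     [B <= rhs ^ (1 / alpha)] and checked for each [f]. *)
  rewrite -[rhs]rootK//; apply: ge0_ler_powR;
    rewrite ?nnegrE ?powR_ge0 ?B0 ?(ltW alpha_gt0)//.
  apply: Ble => f fF; have [_ f0 _ _ ff] := fF.
  apply: root; rewrite ?f0//; apply: le_trans (ff _ _ xI yI) _.
  rewrite -/d.
  have mono z : z \in `[0, 1] ->
      2^-1 * (f z `^ beta + d `^ beta) `^ (alpha / beta) <=
      2^-1 * (B z `^ beta + d `^ beta) `^ (alpha / beta).
    move=> zI; apply: ler_wpM2l; first by rewrite invr_ge0.
    have ab0 : 0 <= alpha / beta by rewrite divr_ge0 ?ltW.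
    apply: (ge0_ler_powR ab0); try by rewrite nnegrE addr_ge0 ?powR_ge0.
    rewrite lerD2r; apply: ge0_ler_powR;
      rewrite ?nnegrE ?f0 ?B0 ?(ltW beta_gt0)//.
    exact: leB.
  by rewrite /rhs; apply: lerD; apply: mono.
(* The bound is inherited from the members: the maximum argument cannot be run on [B], whose
   continuity is still to be shown. *)
have Bb t : t \in `[0, 1] -> 0 <= B t `^ alpha <= 2.
  move=> tI; rewrite powR_ge0/= -[leRHS]rootK//.
  apply: ge0_ler_powR; rewrite ?nnegrE ?powR_ge0 ?B0 ?(ltW alpha_gt0)//.
  by apply: Ble => f fF; apply: (Vub t tI (f t)); exists f.
exists B; split=> //; split=> //.
apply: (@continuous_of_powR _ alpha) => //.
apply: (@approx_midconvex_uniform_continuous _ alpha (fun t => B t `^ alpha))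
  => //; first exact: two_point_ineq_approx_midconvex BB.
- by rewrite B00 powR0.
- by rewrite B01 powR0.
Qed.
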